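(* Let $m \in \mathbb{N}$ with $m \geq 2$. Let $\mathcal{A} : M_n(\mathbb{C}) \to M_n(\mathbb{C})$ be given by $$\mathcal{A}(X) = \sum_{i=1}^m A_i X B_i$$ with $A_i, B_i \in M_n(\mathbb{C})$ Hermitian for $i = 1, \dots, m$. If $\langle \mathcal{A}(X), X \rangle > 0$ for all $X \in M_n(\mathbb{C})$, $X \neq 0$, then there exist positive matrices $A_i', B_i' \in M_n(\mathbb{C})$, $i = 1, \dots, m$, such that $$\mathcal{A}(X) = -A_1' X B_1' + \sum_{i=2}^m A_i' X B_i'$$ for all $X \in M_n(\mathbb{C})$.
   Context: $M_n(\mathbb{C})$ is the space of $n \times n$ complex matrices, $Y^*$ is the conjugate transpose of $Y$, and $\langle X, Y \rangle = \operatorname{trace}(Y^* X)$ is the trace inner product on $M_n(\mathbb{C})$. A matrix $A \in M_n(\mathbb{C})$ is Hermitian if $A = A^*$. A matrix $A \in M_n(\mathbb{C})$ is called positive if $x^* A x > 0$ for all nonzero $x \in \mathbb{C}^n$ (equivalently, $A$ is Hermitian and all its eigenvalues are strictly positive). The condition $\langle \mathcal{A}(X), X\rangle > 0$ means that this quantity is a strictly positive real number. *)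

(* Defs.v *)
From mathcomp Require Export all_boot all_order all_algebra spectral.
From mathcomp Require Export reals complex.
Set Implicit Arguments.
Unset Strict Implicit.
Unset Printing Implicit Defensive.
Import Order.TTheory GRing.Theory Num.Theory.
Local Open Scope ring_scope.
Local Open Scope complex_scope.
Local Open Scope sesquilinear_scope.

Definition mxinner (R : realType) (n : nat) (X Y : 'M[R[i]]_n) : R[i] :=
  \tr (Y ^t* *m X).

(* In the order of [R[i]], [0 < z] means that [z] is real and positive, so
   this condition also forces [A] to be Hermitian. *)
Definition posmx (R : realType) (n : nat) (A : 'M[R[i]]_n) : Prop :=
  forall x : 'cV[R[i]]_n, x != 0 -> 0 < (x ^t* *m A *m x) 0 0.

(* Main.v *)
Require Import Defs.
From HB Require Import structures.
From mathcomp Require Import perm ring.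
Set Implicit Arguments.
Unset Strict Implicit.
Unset Printing Implicit Defensive.
Import Order.TTheory GRing.Theory Num.Theory.
Local Open Scope ring_scope.
Local Open Scope complex_scope.
Local Open Scope sesquilinear_scope.

(** Read [\sum_i A_i X B_i] as the tensor [\sum_i A_i (x) B_i].  Testing the
    hypothesis on the rank one matrices [x y^*] gives
    [\sum_i (x^* A_i x) (y^* B_i y) > 0] for nonzero [x] and [y].
    Hence every [P_y = \sum_i (y^* B_i y) A_i] and every
    [Q_x = \sum_i (x^* A_i x) B_i] is positive.

    A representation with one negative term exists as soon as there are real
    vectors [q] and [c] with [q . c = 0] such that [Q = \sum_i q_i B_i] and
    [P = \sum_i c_i A_i] are both positive ([posdef_tensor_of_functional]).
    Indeed, [Q] can replace some [B_j] on the right ([tensor_exchange]); this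
    turns the other left factors into [A_i - (q_i / q_j) A_j], and because
    [q . c = 0] these still combine to [P], which can replace one of them.
    Adding a large multiple of [P] to the remaining left factors makes them
    positive, at the expense of the right factor of [P] ([tensor_shift]).
    Finally a large multiple of [Q] is added to all the right factors other
    than [Q]; the left factor of [Q] then loses a large multiple of a positive
    matrix and becomes negative.

    To find [q] and [c], fix [y] and put [P = P_y].  Suppose some [H = A_k] is
    not a multiple of [P].  Let [x] and [z] be generalized eigenvectors of the
    pencil [(H, P)], [x] for the largest eigenvalue and [z] for a smaller one,
    and let [q_i = x^* A_i x - e (z^* A_i z)] with [e] small.  Then
    [Q = Q_x - e Q_z] is still positive, but since [x] is extremal, the
    functional [q] vanishes at some positive combination of [P] and [H]
    ([extreme_pair]), whose coefficients on the [A_i] give [c].  If on the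
    contrary all [A_i] are multiples of [P], the tensor is a single product
    [P (x) D] of positive matrices, which is split directly. *)

(** * Hermitian matrices and their quadratic forms *)

Section Forms.
Variable C : numClosedFieldType.

Definition herm n (A : 'M[C]_n) : Prop := A ^t* = A.

Definition form n (A : 'M[C]_n) (x : 'cV[C]_n) : C := (x ^t* *m A *m x) 0 0.

(** Hermitian symmetry is recorded with positivity, as it makes the spectral
    theorem directly applicable and is preserved by real combinations. *)
Definition posdef n (A : 'M[C]_n) : Prop :=
  herm A /\ forall x, x != 0 -> 0 < form A x.

Lemma trmxC_mul m n p (A : 'M[C]_(m, n)) (B : 'M[C]_(n, p)) :
  (A *m B) ^t* = B ^t* *m A ^t*.
Proof. by rewrite trmx_mul map_mxM. Qed.

Lemma hermsymmx_herm n (A : 'M[C]_n) : A \is hermsymmx -> herm A.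
Proof. by move=> /is_hermitianmxP; rewrite expr0 scale1r => /esym. Qed.

Lemma herm_hermsymmx n (A : 'M[C]_n) : herm A -> A \is hermsymmx.
Proof. by move=> hA; apply/is_hermitianmxP; rewrite expr0 scale1r hA. Qed.

Lemma hermD n (A B : 'M[C]_n) : herm A -> herm B -> herm (A + B).
Proof. by rewrite /herm linearD map_mxD /= => -> ->. Qed.

Lemma hermZ n (a : C) (A : 'M[C]_n) : a \is Num.real -> herm A -> herm (a *: A).
Proof. by rewrite /herm linearZ map_mxZ /= => /CrealP -> ->. Qed.

Lemma hermN n (A : 'M[C]_n) : herm A -> herm (- A).
Proof. by rewrite -scaleN1r; apply: hermZ; rewrite rpredN rpred1. Qed.

Lemma herm_sum n (I : finType) (S : pred I) (A : I -> 'M[C]_n) :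
  (forall i, S i -> herm (A i)) -> herm (\sum_(i | S i) A i).
Proof.
move=> hA; elim/big_ind: _ => //; last exact: hermD.
by rewrite /herm linear0 map_mx0.
Qed.

Lemma herm_congr n (A S : 'M[C]_n) : herm A -> herm (S ^t* *m A *m S).
Proof. by move=> hA; rewrite /herm !trmxC_mul trmxCK hA mulmxA. Qed.

Lemma formD n (A B : 'M[C]_n) x : form (A + B) x = form A x + form B x.
Proof. by rewrite /form mulmxDr mulmxDl mxE. Qed.

Lemma formZ n a (A : 'M[C]_n) x : form (a *: A) x = a * form A x.
Proof. by rewrite /form -scalemxAr -scalemxAl mxE. Qed.

Lemma form0 n (x : 'cV[C]_n) : form 0 x = 0.
Proof. by rewrite -(scale0r 0) formZ mul0r. Qed.

Lemma form_sum n (I : finType) (S : pred I) (A : I -> 'M[C]_n) x :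
  form (\sum_(i | S i) A i) x = \sum_(i | S i) form (A i) x.
Proof. exact: (big_morph (fun A => form A x) (fun A B => formD A B x) (form0 x)). Qed.

Lemma form_mulmx n (A S : 'M[C]_n) (x : 'cV[C]_n) :
  form A (S *m x) = form (S ^t* *m A *m S) x.
Proof. by rewrite /form trmxC_mul !mulmxA. Qed.

Lemma form_diag n (d : 'rV[C]_n) (x : 'cV[C]_n) :
  form (diag_mx d) x = \sum_i d 0 i * `|x i 0| ^+ 2.
Proof.
rewrite /form mul_mx_diag mxE; apply: eq_bigr => i _; rewrite !mxE normCK.
by rewrite mulrAC mulrC [X in _ * X]mulrC.
Qed.

Lemma form_delta n (A : 'M[C]_n) i : form A (delta_mx i 0) = A i i.
Proof.
rewrite /form trmx_delta map_delta_mx -rowE -colE !mxE.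
by [].
Qed.

Lemma form_real n (A : 'M[C]_n) x : herm A -> form A x \is Num.real.
Proof.
move=> hA; apply/CrealP; rewrite /form.
have : (x ^t* *m A *m x) ^t* = x ^t* *m A *m x.
  by rewrite !trmxC_mul trmxCK hA mulmxA.
by move=> /matrixP /(_ 0 0); rewrite !mxE.
Qed.

Lemma posdefZ n a (A : 'M[C]_n) : 0 < a -> posdef A -> posdef (a *: A).
Proof.
move=> a0 [hA pA]; split=> [|x x0]; first by apply: hermZ; rewrite ?gtr0_real.
by rewrite formZ mulr_gt0 ?pA.
Qed.

Lemma posdef_neq0 n (A : 'M[C]_n) (x : 'cV[C]_n) : x != 0 -> posdef A -> A != 0.
Proof.
move=> x0 [_ /(_ x x0)]; apply: contraTneq => ->.
by rewrite form0 ltxx.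
Qed.

Lemma posdef_sum n (I : finType) (S : pred I) (A : I -> 'M[C]_n) k : S k ->
  (forall i, S i -> posdef (A i)) -> posdef (\sum_(i | S i) A i).
Proof.
move=> Sk pA; split=> [|x x0]; first by apply: herm_sum => i /pA[].
rewrite form_sum (bigD1 k) //= ltr_wpDr ?(pA k Sk).2 //.
by apply: sumr_ge0 => i /andP[Si _]; rewrite ltW ?(pA i Si).2.
Qed.

Lemma mulmx_unit_neq0 n (S : 'M[C]_n) (x : 'cV[C]_n) :
  S \in unitmx -> x != 0 -> S *m x != 0.
Proof. by move=> uS; apply: contra_neq => e; rewrite -(mulKmx uS x) e mulmx0. Qed.

(** Positivity can be read off any diagonalization by congruence: every vector
    is [S *m y] for some [y]. *)
Lemma posdef_diag_congr n (A S : 'M[C]_n) (d : 'rV[C]_n) :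
  S \in unitmx -> herm A -> S ^t* *m A *m S = diag_mx d ->
  (forall i, 0 < d 0 i) -> posdef A.
Proof.
move=> uS hA dA d0; split=> // x x0.
rewrite -[x](mulKVmx uS) form_mulmx dA form_diag.
set y := invmx S *m x.
have y0 : y != 0 by apply: mulmx_unit_neq0; rewrite ?unitmx_inv.
have [i yi] : exists i, y i 0 != 0 by apply/cV0Pn.
rewrite (bigD1 i) //= ltr_wpDr //; last by rewrite mulr_gt0 ?exprn_gt0 ?normr_gt0.
by apply: sumr_ge0 => j _; rewrite mulr_ge0 ?exprn_ge0 // ltW.
Qed.

(** * Pencils of hermitian matrices *)

Lemma unitary_diag n (A : 'M[C]_n) : herm A ->
  exists U : 'M[C]_n, exists d : 'rV[C]_n,
    [/\ U ^t* *m U = 1%:M, U ^t* *m A *m U = diag_mx d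
      & forall i, d 0 i \is Num.real].
Proof.
move=> /herm_hermsymmx hA; have uV := spectral_unitarymx A.
exists ((spectralmx A) ^t*), (spectral_diag A); rewrite trmxCK; split.
- exact/unitarymxP.
- have /orthomx_spectralP eA := hermitian_normalmx hA.
  rewrite [X in _ *m X *m _]eA -invmx_unitary // !mulmxA.
  by rewrite mulmxV ?mul1mx ?mulmxK ?spectral_unit.
- by move=> i; have /mxOverP := hermitian_spectral_diag_real hA; apply.
Qed.

(** A positive [P] can be taken as the inner product: after a congruence by
    some [T] that turns [P] into the identity, a unitary change of basis
    diagonalizes the image of [H] and fixes the identity. *)
Lemma simdiag n (P H : 'M[C]_n) : posdef P -> herm H ->
  exists S : 'M[C]_n, exists d : 'rV[C]_n,
    [/\ S \in unitmx, S ^t* *m P *m S = 1%:M, S ^t* *m H *m S = diag_mx d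
      & forall i, d 0 i \is Num.real].
Proof.
move=> [hP pP] hH.
have [U [e [UU Pe _]]] := unitary_diag hP.
have uU : U \in unitmx by have [] := mulmx1_unit UU.
have e0 i : 0 < e 0 i.
  suff -> : e 0 i = form P (U *m delta_mx i 0).
    apply: pP; apply: mulmx_unit_neq0 => //; apply/cV0Pn; exists i.
    by rewrite mxE !eqxx oner_eq0.
  by rewrite form_mulmx Pe form_delta mxE eqxx.
(* [T] is [P] to the power -1/2, up to a unitary factor. *)
pose r : 'rV[C]_n := \row_i (sqrtC (e 0 i))^-1.
pose T := U *m diag_mx r.
have TC : T ^t* = diag_mx r *m U ^t*.
  rewrite trmxC_mul tr_diag_mx map_diag_mx; congr (diag_mx _ *m _).
  apply/rowP => i; rewrite !mxE; apply/CrealP; rewrite ger0_real //.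
  by rewrite invr_ge0 sqrtC_ge0 ltW.
have TP : T ^t* *m P *m T = 1%:M.
  rewrite TC /T !mulmxA -(mulmxA (diag_mx r)) -(mulmxA (diag_mx r)) Pe.
  rewrite !mulmx_diag; apply/matrixP => i j; rewrite !mxE.
  case: eqP => // _; rewrite !mulr1n mulrAC -invfM -expr2 sqrtCK mulVf //.
  by rewrite gt_eqF.
have [V [d [VV Hd dR]]] := unitary_diag (herm_congr T hH).
have SP : (T *m V) ^t* *m P *m (T *m V) = 1%:M.
  have -> : (T *m V) ^t* *m P *m (T *m V) = V ^t* *m (T ^t* *m P *m T) *m V.
    by rewrite trmxC_mul !mulmxA.
  by rewrite TP mulmx1.
exists (T *m V), d; split=> //.
  by have [] := mulmx1_unit SP.
by rewrite trmxC_mul -Hd !mulmxA.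
Qed.

(** In a basis where [P] is the identity and [H] is diagonal, it suffices that
    [t] exceeds the absolute values of all eigenvalues of [H]; their sum is a
    convenient threshold.  Having a threshold allows one [t] to serve several
    matrices at once. *)
Lemma posdef_absorb n (P H : 'M[C]_n) : posdef P -> herm H ->
  exists2 t0, 0 <= t0 & forall t, t0 < t -> posdef (H + t *: P).
Proof.
move=> pP hH; have [S [d [uS SP SH dR]]] := simdiag pP hH.
exists (\sum_i `|d 0 i|); first exact: sumr_ge0.
move=> t tt; have t0 : 0 < t by apply: le_lt_trans tt; apply: sumr_ge0.
apply: (posdef_diag_congr (d := \row_i (d 0 i + t)) uS).
- by apply: hermD => //; apply: hermZ; [exact: gtr0_real | case: pP].
- rewrite mulmxDr mulmxDl SH -scalemxAr -scalemxAl SP.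
  by apply/matrixP => i j; rewrite !mxE; case: eqP => _; rewrite ?mulr1n ?mulr1 ?mulr0n ?mulr0 ?addr0.
- move=> i; rewrite mxE -(opprK (d 0 i)) addrC subr_gt0.
  apply: le_lt_trans tt; apply: (le_trans (real_ler_norm _)); rewrite ?rpredN //.
  by rewrite normrN (bigD1 i) //= lerDl sumr_ge0.
Qed.

Lemma posdef_absorb_fam n (I : finType) (P : 'M[C]_n) (H : I -> 'M[C]_n) :
  posdef P -> (forall i, herm (H i)) ->
  exists2 t0, 0 <= t0 & forall t, t0 < t -> forall i, posdef (H i + t *: P).
Proof.
move=> pP hH.
have /fin_all_exists[t ht] i : exists t, 0 <= t /\ forall s, t < s -> posdef (H i + s *: P).
  by have [t t0 ht] := posdef_absorb pP (hH i); exists t.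
exists (\sum_i t i); first by apply: sumr_ge0 => i _; case: (ht i).
move=> s ts i; apply: (ht i).2; apply: le_lt_trans ts.
by rewrite (bigD1 i) //= lerDl sumr_ge0 // => k _; case: (ht k).
Qed.

(** This is where a functional that is not positive is obtained.  Let [d] be
    the eigenvalues of [H] relative to [P], let [x] be an eigenvector for the
    largest one [d_i], and [z] one for some [d_j < d_i].  The functional
    [M |-> form M x - e * form M z] vanishes at the combination of [P] and [H]
    with eigenvalues [(1 - e) (d_i - d_k) + e (d_i - d_j)], which are positive
    because [d_i] is maximal. *)
Lemma extreme_pair n (P H : 'M[C]_n) : posdef P -> herm H ->
  (forall c, H != c *: P) ->
  exists x : 'cV[C]_n, exists z : 'cV[C]_n,
  [/\ x != 0, z != 0 & forall e, 0 < e -> e < 1 ->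
    exists a, exists b, [/\ a \is Num.real, b \is Num.real, posdef (a *: P + b *: H)
      & a * (form P x - e * form P z) + b * (form H x - e * form H z) = 0]].
Proof.
move=> pP hH HP; have [S [d [uS SP SH dR]]] := simdiag pP hH.
(* In dimension 0 every matrix is a multiple of [P]. *)
case: n P H pP hH HP S d uS SP SH dR => [|n] P H pP hH HP S d uS SP SH dR.
  by case/eqP: (HP 0); apply/matrixP => -[].
pose i := [arg max_(i > (ord0 : 'I_n.+1)) d 0 i]%O.
have di k : d 0 k <= d 0 i.
  by rewrite /i; case: real_arg_maxP => // {}i _; apply.
have [j dij] : exists j, d 0 j < d 0 i.
  apply/existsP; apply: contraT; rewrite negb_exists => /forallP dj.
  case/eqP: (HP (d 0 i)).
  apply: (can_inj (mulKmx (_ : S ^t* \in unitmx))).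
    by rewrite map_unitmx unitmx_tr.
  apply: (can_inj (mulmxK uS)).
  rewrite -scalemxAr -scalemxAl SP SH; apply/matrixP => k l; rewrite !mxE.
  case: eqP => [_|]; rewrite ?mulr1n ?mulr1 ?mulr0n ?mulr0 //.
  by apply/eqP; move: (dj k); rewrite lt_neqAle di andbT negbK.
have e0 k : (delta_mx k 0 : 'cV[C]_n.+1) != 0.
  by apply/cV0Pn; exists k; rewrite mxE !eqxx oner_eq0.
have fP k : form P (S *m delta_mx k 0) = 1.
  by rewrite form_mulmx SP form_delta mxE eqxx.
have fH k : form H (S *m delta_mx k 0) = d 0 k.
  by rewrite form_mulmx SH form_delta mxE eqxx.
exists (S *m delta_mx i 0), (S *m delta_mx j 0).
split; try exact: mulmx_unit_neq0.
move=> e e_gt0 e_lt1.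
have eR : e \is Num.real by rewrite gtr0_real.
exists (d 0 i - e * d 0 j), (e - 1).
have aR : d 0 i - e * d 0 j \is Num.real by rewrite realB ?realM.
have bR : e - 1 \is Num.real by rewrite realB.
split=> //; last by rewrite !fP !fH; ring.
apply: (posdef_diag_congr (d := \row_k ((1 - e) * (d 0 i - d 0 k) + e * (d 0 i - d 0 j))) uS).
- by apply: hermD; apply: hermZ => //; case: pP.
- rewrite mulmxDr mulmxDl -!scalemxAr -!scalemxAl SH SP.
  apply/matrixP => k l; rewrite !mxE; case: eqP => _; rewrite ?mulr1n ?mulr0n; ring.
- move=> k; rewrite mxE ltr_wpDl //; last by rewrite mulr_gt0 ?subr_gt0.
  by rewrite mulr_ge0 ?subr_ge0 // ltW.
Qed.

(** * Rewriting sums of tensors *)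

Section Tensor.
Variables (V W U : lmodType C) (f : V -> W -> U).
Hypotheses (fl : forall w, linear (f^~ w)) (fr : forall v, linear (f v)).

Let Fl w : {linear V -> U} :=
  HB.pack (f^~ w) (GRing.isLinear.Build _ _ _ _ (f^~ w) (fl w)).
Let Fr v : {linear W -> U} :=
  HB.pack (f v) (GRing.isLinear.Build _ _ _ _ (f v) (fr v)).

Let fDl v v' w : f (v + v') w = f v w + f v' w. Proof. exact: (linearD (Fl w)). Qed.
Let fZl x v w : f (x *: v) w = x *: f v w. Proof. exact: (linearZ_LR (Fl w)). Qed.
Let fBr v w w' : f v (w - w') = f v w - f v w'. Proof. exact: (linearB (Fr v)). Qed.
Let fZr x v w : f v (x *: w) = x *: f v w. Proof. exact: (linearZ_LR (Fr v)). Qed.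

(** Steinitz exchange on the left factors: [a k] is solved from
    [p = \sum_i c i *: a i] and [p] takes its place, without changing the
    number of terms.  With the flipped [f], the same statement
    exchanges a right factor. *)
Lemma tensor_exchange (I : finType) (S : pred I) (a : I -> V) (b : I -> W)
  (c : I -> C) k : S k -> c k != 0 ->
  \sum_(i | S i) f (a i) (b i) =
    f (\sum_(i | S i) c i *: a i) ((c k)^-1 *: b k) +
    \sum_(i | S i && (i != k)) f (a i) (b i - (c i / c k) *: b k).
Proof.
move=> Sk ck.
rewrite [f (\sum_(i | _) _) _](linear_sum (Fl ((c k)^-1 *: b k))) /=.
rewrite (bigD1 k) //= [in RHS](bigD1 k) //= fZl fZr scalerA divff // scale1r.
rewrite -addrA; congr (_ + _); rewrite -big_split /=; apply: eq_bigr => i _.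
by rewrite fZl fBr !fZr scalerA addrC subrK.
Qed.

(** A multiple of one left factor may be added to all the others if the right
    factor of that term compensates; this is what makes left factors positive
    at no cost in the number of terms. *)
Lemma tensor_shift (I : finType) (S : pred I) (a : I -> V) (b : I -> W)
  (p : V) (q : W) t :
  f p q + \sum_(i | S i) f (a i) (b i) =
    f p (q - t *: \sum_(i | S i) b i) + \sum_(i | S i) f (a i + t *: p) (b i).
Proof.
rewrite fBr fZr [f p (\sum_(i | _) _)](linear_sum (Fr p)) /=.
rewrite -addrA; congr (_ + _); rewrite addrC scaler_sumr -sumrB.
by apply: eq_bigr => i _; rewrite fDl fZl addrK.
Qed.

End Tensor.

(** * Splitting off one negative term *)

Lemma sandwich_linearl n (X B : 'M[C]_n) : linear (fun A : 'M[C]_n => A *m X *m B).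
Proof. by move=> a A A'; rewrite !mulmxDl -!scalemxAl. Qed.

Lemma sandwich_linearr n (X A : 'M[C]_n) : linear (fun B : 'M[C]_n => A *m X *m B).
Proof. by move=> b B B'; rewrite mulmxDr -!scalemxAr. Qed.

(** The real vectors [q] and [c] encode a functional and a point of the span of
    the [A i].  The condition [q . c = 0] leaves [P] in the span of the left
    factors that remain once [Q] has been exchanged for a right factor, so both
    [Q] and [P] can be made factors, of two different terms. *)
Lemma posdef_tensor_of_functional n (I : finType) (A B : I -> 'M[C]_n)
  (q c : I -> C) (y : 'cV[C]_n) : y != 0 ->
  (forall i, herm (A i)) -> (forall i, herm (B i)) ->
  (forall i, q i \is Num.real) -> (forall i, c i \is Num.real) ->
  posdef (\sum_i q i *: B i) -> posdef (\sum_i c i *: A i) ->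
  \sum_i q i * c i = 0 ->
  exists j, exists A' B' : I -> 'M[C]_n,
    (forall i, posdef (A' i) /\ posdef (B' i)) /\
    forall X, \sum_i A i *m X *m B i =
      - (A' j *m X *m B' j) + \sum_(i | i != j) A' i *m X *m B' i.
Proof.
move=> y0 hA hB qR cR; set Q := \sum_i _; set P := \sum_i c i *: _ => pQ pP qc.
have [j qj] : exists j, q j != 0.
  apply/existsP; apply: contraT; rewrite negb_exists => /forallP q0.
  case/eqP: (posdef_neq0 y0 pQ); apply: big1 => i _.
  by move: (q0 i); rewrite negbK => /eqP ->; rewrite scale0r.
(* The left factors once [Q] has replaced [B j]; [A1 j = 0]. *)
pose A1 i := A i - (q i / q j) *: A j.
have hA1 i : herm (A1 i).
  by apply: hermD => //; apply/hermN/hermZ => //; rewrite realM ?realV.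
have PE : P = \sum_(i | i != j) c i *: A1 i.
  apply: (@eq_trans _ _ (\sum_i c i *: A1 i)).
    under [RHS]eq_bigr do rewrite scalerBr scalerA.
    rewrite sumrB -scaler_suml.
    rewrite (_ : \sum_i c i * (q i / q j) = 0) ?scale0r ?subr0 //.
    under eq_bigr do rewrite mulrA (mulrC (c _)).
    by rewrite -mulr_suml qc mul0r.
  by rewrite (bigD1 j) //= /A1 divff // scale1r subrr scaler0 add0r.
have [k kj ck] : exists2 k, k != j & c k != 0.
  apply/exists_inP; apply: contraT; rewrite negb_exists_in => /forall_inP c0.
  case/eqP: (posdef_neq0 y0 pP); rewrite PE; apply: big1 => i /c0.
  by rewrite negbK => /eqP ->; rewrite scale0r.
(* The right factors once [P] has replaced [A1 k]. *)
pose B2 i := B i - (c i / c k) *: B k.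
have hB2 i : herm (B2 i).
  by apply: hermD => //; apply/hermN/hermZ => //; rewrite realM ?realV.
have [t0 t0_ge0 /(_ (t0 + 1))] := posdef_absorb_fam pP hA1.
rewrite ltrDl ltr01 => /(_ isT); set t := t0 + 1 => ht.
have tR : t \is Num.real by rewrite gtr0_real // ltr_wpDl.
(* The terms of index other than [j] once [t *: P] has been added on the left. *)
pose A3 i := if i == k then P else A1 i + t *: P.
pose B3 i := if i == k then
  (c k)^-1 *: B k - t *: \sum_(l | (l != j) && (l != k)) B2 l else B2 i.
have pA3 i : posdef (A3 i) by rewrite /A3; case: eqP.
have hB3 i : herm (B3 i).
  rewrite /B3; case: eqP => // _; apply: hermD.
    by apply: hermZ; rewrite ?realV.
  by apply/hermN/hermZ => //; apply: herm_sum.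
have pS : posdef (\sum_(i | i != j) A3 i) by apply: (posdef_sum (S := fun i => i != j) kj).
have hAj : herm (- ((q j)^-1 *: A j)) by apply/hermN/hermZ; rewrite ?realV.
have [r1 r1_ge0 hr1] := posdef_absorb_fam pQ hB3.
have [r2 r2_ge0 hr2] := posdef_absorb pS hAj.
(* [s] makes the right factors [B3 i + s *: Q] positive and the left factor of
   [Q] negative. *)
pose s := r1 + r2 + 1.
have {}hr1 : forall i, posdef (B3 i + s *: Q).
  by apply: hr1; rewrite /s -addrA ltrDl ltr_wpDl.
have {}hr2 : posdef (- ((q j)^-1 *: A j) + s *: \sum_(i | i != j) A3 i).
  by apply: hr2; rewrite /s addrAC ltrDr ltr_wpDl.
exists j, (fun i => if i == j then - ((q j)^-1 *: A j) + s *: \sum_(l | l != j) A3 l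
                    else A3 i),
  (fun i => if i == j then Q else B3 i + s *: Q).
split=> [i|X]; first by case: eqP.
have fl := sandwich_linearl X; have fr := sandwich_linearr X.
rewrite eqxx.
rewrite (tensor_exchange (f := fun b a => a *m X *m b) fr fl (S := predT) B A
           (k := j) isT qj) /= -/Q.
rewrite (tensor_exchange (f := fun a b => a *m X *m b) fl fr (S := [pred i | i != j])
           A1 B kj ck) /= -PE.
have -> : P *m X *m ((c k)^-1 *: B k) +
    \sum_(i | (i != j) && (i != k)) A1 i *m X *m B2 i =
    \sum_(i | i != j) A3 i *m X *m B3 i.
  rewrite (tensor_shift (f := fun a b => a *m X *m b) fl fr _ A1 B2 P _ t).
  rewrite [in RHS](bigD1 k) //= /A3 /B3 eqxx; congr (_ + _).
  by apply: eq_bigr => i /andP[_ /negPf ->].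
rewrite (tensor_shift (f := fun b a => a *m X *m b) fr fl _ B3 A3 Q _ s).
congr (_ + _).
  by rewrite -!mulNmx opprD opprK.
by apply: eq_bigr => i /negPf ->.
Qed.

(** Rank one matrices turn the positivity of the operator into a positivity
    statement about the forms of the two families of factors. *)
Lemma tr_sandwich_rank1 n (A B : 'M[C]_n) (x y : 'cV[C]_n) :
  \tr ((x *m y ^t*) ^t* *m (A *m (x *m y ^t*) *m B)) = form A x * form B y.
Proof.
rewrite trmxC_mul trmxCK mxtrace_mulC.
have -> : A *m (x *m y ^t*) *m B *m (y *m x ^t*) =
  (A *m x) *m ((y ^t* *m B *m y) *m x ^t*) by rewrite !mulmxA.
rewrite mxtrace_mulC.
have -> : y ^t* *m B *m y *m x ^t* *m (A *m x) =
  (y ^t* *m B *m y) *m (x ^t* *m A *m x) by rewrite !mulmxA.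
by rewrite trace_mx11 mxE big_ord1 mulrC.
Qed.

(** The functional [q] is built from an extremal vector [x] of a pencil spanned by two of the left factors, and
    the perturbation by [z] is small enough, namely [1 / t], to keep
    [Q x - t^-1 *: Q z] positive. *)
Lemma posdef_tensor n (I : finType) (A B : I -> 'M[C]_n) (y : 'cV[C]_n) :
  y != 0 -> (1 < #|I|)%N ->
  (forall i, herm (A i)) -> (forall i, herm (B i)) ->
  (forall x z, x != 0 -> z != 0 -> 0 < \sum_i form (A i) x * form (B i) z) ->
  exists j, exists A' B' : I -> 'M[C]_n,
    (forall i, posdef (A' i) /\ posdef (B' i)) /\
    forall X, \sum_i A i *m X *m B i =
      - (A' j *m X *m B' j) + \sum_(i | i != j) A' i *m X *m B' i.
Proof.
move=> y0 I1 hA hB AB_gt0.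
pose P := \sum_i form (B i) y *: A i.
pose Q x := \sum_i form (A i) x *: B i.
have formP x : form P x = \sum_i form (A i) x * form (B i) y.
  by rewrite form_sum; apply: eq_bigr => i _; rewrite formZ mulrC.
have pP : posdef P.
  split=> [|x x0]; last by rewrite formP AB_gt0.
  by apply: herm_sum => i _; apply: hermZ => //; apply: form_real.
have pQ x : x != 0 -> posdef (Q x).
  move=> x0; split=> [|z z0].
    by apply: herm_sum => i _; apply: hermZ => //; apply: form_real.
  by rewrite form_sum; under eq_bigr do rewrite formZ; apply: AB_gt0.
case: (boolP [forall i, A i == (form (A i) y / form P y) *: P]) => [/forallP AP|].
  (* All left factors are multiples of [P], and the operator is [P *m X *m D].
     With [k + 1] terms besides the one of index [j], the coefficients
     [2 (k + 1)] and [- (2 k + 1)] of [D] add up to 1. *)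
  have Py_gt0 : 0 < form P y by case: pP => _; apply.
  pose D := (form P y)^-1 *: Q y.
  have pD : posdef D by apply: posdefZ (pQ y y0); rewrite invr_gt0.
  have [j _] : exists j : I, j \in I by apply/card_gt0P/ltnW.
  have [k cj] : exists k, #|[pred i : I | i != j]| = k.+1.
    by exists #|I|.-2; rewrite cardC1; case: #|I| I1 => [|[|k]].
  exists j, (fun=> P), (fun i => if i == j then (k.*2.+1)%:R *: D else 2 *: D).
  split=> [i|X].
    by split=> //; case: eqP => _; apply: posdefZ; rewrite ?ltr0n.
  rewrite eqxx.
  under [in RHS]eq_bigr => i /negPf-> do rewrite -scalemxAr.
  rewrite sumr_const cj -scalemxAr.
  rewrite -[X in _ + X]scaler_nat scalerA -scaleNr -scalerDl.
  have -> : - (k.*2.+1)%:R + k.+1%:R * 2%:R = 1 :> C.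
    by rewrite -natrM muln2 doubleS -[in X in _ + X]addn1 natrD addKr.
  rewrite scale1r /D /Q -scalemxAr mulmx_sumr scaler_sumr; apply: eq_bigr => i _.
  by rewrite {1}(eqP (AP i)) -!scalemxAl -scalemxAr scalerA mulrC.
rewrite negb_forall => /existsP[k Ak].
have AkP c : A k != c *: P.
  apply: contra_neq Ak => ->; rewrite formZ mulfK // gt_eqF //.
  by case: pP => _; apply.
have [x [z [x0 z0 xz]]] := extreme_pair pP (hA k) AkP.
have [t0 t0_ge0 ht] := posdef_absorb (pQ x x0) (hermN (pQ z z0).1).
pose t := t0 + 2.
have t_gt1 : 1 < t by rewrite /t ltr_wpDl // ltr1n.
have t_gt0 : 0 < t by apply: lt_trans t_gt1.
have [a [b [aR bR pab ab0]]] : exists a, exists b, [/\ a \is Num.real, b \is Num.real,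
    posdef (a *: P + b *: A k)
    & a * (form P x - t^-1 * form P z) + b * (form (A k) x - t^-1 * form (A k) z) = 0].
  by apply: xz; rewrite ?invr_gt0 ?invf_lt1.
pose q i := form (A i) x - t^-1 * form (A i) z.
(* The coordinates of [a *: P + b *: A k] on the family [A]. *)
pose c i := a * form (B i) y + (if i == k then b else 0).
apply: (@posdef_tensor_of_functional _ _ A B q c y) => //.
- by move=> i; rewrite /q realB ?realM ?form_real ?realV ?gtr0_real.
- move=> i; rewrite /c realD ?realM ?form_real //.
  by case: ifP.
- have -> : \sum_i q i *: B i = t^-1 *: (- Q z + t *: Q x).
    rewrite scalerDr scalerA mulVf ?gt_eqF // scale1r scalerN addrC.
    rewrite /Q scaler_sumr -sumrB; apply: eq_bigr => i _.
    by rewrite scalerBl scalerA.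
  by apply: posdefZ; rewrite ?invr_gt0 //; apply: ht; rewrite /t ltrDl.
- have -> // : \sum_i c i *: A i = a *: P + b *: A k.
  under eq_bigr do rewrite scalerDl.
  rewrite big_split /= scaler_sumr; congr (_ + _).
    by apply: eq_bigr => i _; rewrite scalerA.
  rewrite (bigD1 k) //= eqxx big1 ?addr0 // => i /negPf ->.
  by rewrite scale0r.
- rewrite -[RHS]ab0 !formP mulr_sumr -sumrB mulr_sumr.
  under [LHS]eq_bigr do rewrite /c mulrDr.
  rewrite big_split /=; congr (_ + _).
    by apply: eq_bigr => i _; rewrite /q; ring.
  rewrite (bigD1 k) //= eqxx big1 ?addr0 1?mulrC // => i /negPf ->.
  by rewrite mulr0.
Qed.

End Forms.

Theorem theorem4p5 (R : realType) (n m : nat) (hm : (2 <= m)%N)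
  (calA : 'M[R[i]]_n -> 'M[R[i]]_n) (A B : nat -> 'M[R[i]]_n)
  (hA : forall i : nat, (1 <= i <= m)%N -> A i \is hermsymmx)
  (hB : forall i : nat, (1 <= i <= m)%N -> B i \is hermsymmx)
  (hcalA : forall X : 'M[R[i]]_n,
     calA X = \sum_(1 <= i < m.+1) A i *m X *m B i)
  (hpos : forall X : 'M[R[i]]_n, X != 0 -> 0 < mxinner (calA X) X) :
  exists A' B' : nat -> 'M[R[i]]_n,
    (forall i : nat, (1 <= i <= m)%N -> posmx (A' i) /\ posmx (B' i)) /\
    (forall X : 'M[R[i]]_n,
       calA X = - (A' 1%N *m X *m B' 1%N)
                + \sum_(2 <= i < m.+1) A' i *m X *m B' i).
Proof.
(* In dimension 0 positivity is vacuous and all matrices are equal; a nonzero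
   vector is needed below. *)
case: n calA A B hA hB hcalA hpos => [|n] calA A B hA hB hcalA hpos.
  exists A, B; split=> [i _|X]; last by rewrite [LHS]flatmx0 [RHS]flatmx0.
  by split=> x; rewrite [x]flatmx0 eqxx.
case: m hm hA hB hcalA => [|m] // hm hA hB hcalA.
have hcalA' X : calA X = \sum_(i < m.+1) A i.+1 *m X *m B i.+1.
  by rewrite hcalA big_add1 big_mkord.
have delta0 : (delta_mx 0 0 : 'cV[R[i]]_n.+1) != 0.
  by apply/cV0Pn; exists 0; rewrite mxE oner_eq0.
have [||||j [A' [B' [pAB eAB]]]] := @posdef_tensor _ _ 'I_m.+1
    (fun i => A i.+1) (fun i => B i.+1) _ delta0.
- by rewrite card_ord.
- by move=> i; apply/hermsymmx_herm/hA; rewrite /= ltn_ord.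
- by move=> i; apply/hermsymmx_herm/hB; rewrite /= ltn_ord.
- move=> x z x0 z0.
  have /hpos : x *m z ^t* != 0.
    have [k xk] : exists k, x k 0 != 0 by apply/cV0Pn.
    have [l zl] : exists l, z l 0 != 0 by apply/cV0Pn.
    apply/eqP => /matrixP /(_ k l); rewrite !mxE big_ord1 !mxE.
    by apply/eqP; rewrite mulf_neq0 // conjC_eq0.
  rewrite /mxinner hcalA' mulmx_sumr raddf_sum /=.
  by under eq_bigr do rewrite tr_sandwich_rank1.
(* The negative term has some index [j], which is moved to the first place. *)
pose s (i : nat) : 'I_m.+1 := tperm 0 j (inord i.-1).
exists (A' \o s), (B' \o s); split=> [i _|X]; first by case: (pAB (s i)) => -[_ ?] [_ ?].
rewrite hcalA' eAB.
have s1 : s 1%N = j.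
  by rewrite /s /= (_ : inord 0 = 0) ?tpermL //; apply/val_inj; rewrite /= inordK.
have s2 (i : 'I_m) : s i.+2 = tperm 0 j (lift ord0 i).
  by rewrite /s; congr (tperm _ _ _); apply/val_inj; rewrite /= inordK // ltnS.
rewrite /comp s1; congr (_ + _).
rewrite big_add1 big_add1 /= big_mkord; under [RHS]eq_bigr do rewrite s2.
rewrite (reindex_inj (@perm_inj _ (tperm 0 j))) big_mkcond big_ord_recl /=.
rewrite tpermL eqxx add0r; apply: eq_bigr => i _.
by rewrite -{2}[j](tpermL 0) (inj_eq perm_inj).
Qed.
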